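(* Let $(\sigma_n)_{n\ge1}$ be a sequence of real numbers with $\sigma_n>0$ for all $n$ and $\sigma_n\to\infty$. Let $f_n(x):=e^{\sigma_nx}$ for $x\in\mathbb{R}$, and $f:=\sum_{n\ge1}f_n:\mathbb{R}\to[0,\infty]$. Assume that $\operatorname{dom}f\ne\emptyset$, and so $I:=(-\infty,-\alpha)\subset\operatorname{dom}f\subset\operatorname{cl}I$ for some $\alpha\in[0,\infty)$. (i) Then $\partial f(\operatorname{int}(\operatorname{dom}f))=(0,\gamma)$, where $\gamma:=\sum_{n\ge1}\sigma_ne^{-\sigma_n\alpha}\in[0,\infty]$, $\operatorname{dom}f^*=[0,\infty)$, and $$f^*(u)\le\inf\Big\{\sum_{n\ge1}f_n^*(u_n)\ \Big|\ (u_n)_{n\ge1}\subset(\operatorname{dom}f_n^* )_{n\ge1},\ u=\sum_{n\ge1}u_n\Big\}<\infty\qquad\forall u\in[0,\infty).$$ (ii) Let $u\in[0,\infty)$ $(=\operatorname{dom}f^* )$. Then $u\in[0,\gamma]\cap\mathbb{R}$ if and only if $$f^*(u)=\min\Big\{\sum_{n\ge1}f_n^*(u_n)\ \Big|\ (u_n)_{n\ge1}\subset(\operatorname{dom}f_n^* )_{n\ge1},\ u=\sum_{n\ge1}u_n\Big\},$$ or, equivalently, $$f^*(u)=\min\Big\{\sum_{n\ge1}u_n(\ln u_n-1)\ \Big|\ (u_n)_{n\ge1}\subset[0,\infty),\ u=\sum_{n\ge1}\sigma_nu_n\Big\}. \qquad(\ast)$$ More precisely, the minimum in $(\ast)$ is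 attained for $u_n=0$ $(n\ge1)$ when $u=0$; for $u_n=e^{\sigma_nx}$ $(n\ge1)$ when $u=f'(x)$ with $x\in I$; and for $u_n=e^{-\sigma_n\alpha}$ $(n\ge1)$ when $u=\gamma$ $(<\infty)$ (in which case $\alpha\in(0,\infty)$, $-\alpha\in\operatorname{dom}\partial f=\operatorname{dom}f$ and $f'_-(-\alpha)=\gamma$). (iii) Let $u\in[0,\infty)$ $(=\operatorname{dom}f^* )$. Then $$f^*(u)=\inf\Big\{\sum_{n\ge1}f_n^*(u_n)\ \Big|\ (u_n)_{n\ge1}\subset(\operatorname{dom}f_n^* )_{n\ge1},\ u=\sum_{n\ge1}u_n\Big\}$$ $$=\inf\Big\{\sum_{n\ge1}u_n(\ln u_n-1)\ \Big|\ (u_n)_{n\ge1}\subset[0,\infty),\ u=\sum_{n\ge1}\sigma_nu_n\Big\}.$$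
   Context: $f(x)=\sum_{n\ge1}f_n(x)$ is the limit in $[0,\infty]$ of the partial sums; $\operatorname{dom}f=\{x:f(x)<\infty\}$. The conjugate of $g:\mathbb{R}\to(-\infty,\infty]$ is $g^*(u)=\sup_{x\in\mathbb{R}}(xu-g(x))$, and $\operatorname{dom}g^*=\{u:g^*(u)<\infty\}$. For $x\in\operatorname{dom}f$, $\partial f(x)=\{u\in\mathbb{R}:u(y-x)\le f(y)-f(x)\ \forall y\in\mathbb{R}\}$, $\partial f(x)=\emptyset$ otherwise; $\operatorname{dom}\partial f=\{x:\partial f(x)\ne\emptyset\}$ and $\partial f(A)=\bigcup_{x\in A}\partial f(x)$. $f'_-$ is the left derivative. The notation $(u_n)_{n\ge1}\subset(A_n)_{n\ge1}$ means $u_n\in A_n$ for every $n\ge1$. Infinite sums are limits of partial sums; the objective sums $\sum_{n\ge1}f_n^*(u_n)$ and $\sum_{n\ge1}u_n(\ln u_n-1)$ are limits in $(-\infty,\infty]$. Conventions: $0\cdot\ln0:=0$; ''$\min$'' means that the infimum is attained. *)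

(* Defs.v *)
From HB Require Import structures.
From mathcomp Require Import all_boot all_order all_algebra.
From mathcomp Require Import all_classical all_reals all_analysis.

Set Implicit Arguments.
Unset Strict Implicit.
Unset Printing Implicit Defensive.

Import Order.TTheory GRing.Theory Num.Theory.
Import numFieldNormedType.Exports.

Local Open Scope classical_set_scope.
Local Open Scope ring_scope.
Local Open Scope ereal_scope.

Definition edom {R : realType} (g : R -> \bar R) : set R :=
  [set x | g x < +oo].

(* Meant for functions g that never take the value -oo. *)
Definition fconj {R : realType} (g : R -> \bar R) (u : R) : \bar R :=
  ereal_sup [set (x * u)%:E - g x | x in [set: R]].

Definition subdiff {R : realType} (g : R -> \bar R) (x : R) : set R :=
  [set u | edom g x /\ forall y : R, (u * (y - x))%:E <= g y - g x].

Definition dom_subdiff {R : realType} (g : R -> \bar R) : set R :=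
  [set x | subdiff g x !=set0].

Definition subdiff_image {R : realType} (g : R -> \bar R) (A : set R) : set R :=
  \bigcup_(x in A) subdiff g x.

(* The quotient is taken in \bar R; finiteness of g x makes it meaningful even
   at points y where g y is infinite. *)
Definition has_left_derivative {R : realType} (g : R -> \bar R) (x : R)
    (l : \bar R) : Prop :=
  g x \is a fin_num /\
  (g y - g x) * ((y - x)^-1)%:E @[y --> x^'-] --> l.

(* All sequences are indexed from 0 instead of 1. *)
Definition exp_term {R : realType} (sigma : nat -> R) (n : nat) (x : R)
  : \bar R := (expR (sigma n * x))%:E.

Definition exp_series {R : realType} (sigma : nat -> R) (x : R) : \bar R :=
  \sum_(0 <= n <oo) exp_term sigma n x.

(* [m] is the minimum of [phi] over [F]: the infimum, and attained. *)
Definition is_min_at {R : realType} {X : Type} (F : set X) (phi : X -> \bar R)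
    (m : \bar R) (v : X) : Prop :=
  [/\ F v, phi v = m & m = ereal_inf [set phi w | w in F]].

Definition is_min {R : realType} {X : Type} (F : set X) (phi : X -> \bar R)
    (m : \bar R) : Prop :=
  exists v : X, is_min_at F phi m v.

Definition conj_feasible {R : realType} (g : nat -> R -> \bar R) (u : R)
  : set (nat -> R) :=
  [set v | (forall n, edom (fconj (g n)) (v n)) /\ series v @ \oo --> u].

Definition conj_partial {R : realType} (g : nat -> R -> \bar R) (v : nat -> R)
    (N : nat) : \bar R :=
  \sum_(0 <= n < N) fconj (g n) (v n).

(* [limn] is total; it is a genuine limit only if the partial sums converge. *)
Definition conj_objective {R : realType} (g : nat -> R -> \bar R)
    (v : nat -> R) : \bar R :=
  limn (conj_partial g v).

Definition entropy_feasible {R : realType} (sigma : nat -> R) (u : R)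
  : set (nat -> R) :=
  [set v | (forall n, (0 <= v n)%R) /\
           series (fun n => (sigma n * v n)%R) @ \oo --> u].

(* The convention 0 * ln 0 = 0 holds since [ln 0] is a real number. *)
Definition entropy_partial {R : realType} (v : nat -> R) (N : nat) : \bar R :=
  \sum_(0 <= n < N) (v n * (ln (v n) - 1))%:E.

Definition entropy_objective {R : realType} (v : nat -> R) : \bar R :=
  limn (entropy_partial v).

(* Main.v *)
(* Young's inequality y v - e^y <= v (ln v - 1), with equality iff v = e^y,
   applied with y = sigma_n x and summed over n, gives x u - f(x) <= sum of
   v_n (ln v_n - 1) whenever sum sigma_n v_n = u, hence weak duality.  Equality
   forces v_n = e^{sigma_n x}, so u = sum sigma_n e^{sigma_n x}, which is f'(x)
   for x < -alpha and gamma for x = -alpha; since f' increases continuously from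
   0 to gamma, the minimum is attained for 0 < u <= gamma, and trivially for
   u = 0.  If u > gamma, then f*(u) = -alpha u - f(-alpha), attainment would
   force u = gamma, and the values of the problems truncated to the first N
   terms converge to f*(u). *)
Require Import Defs.
From HB Require Import structures.
From mathcomp Require Import all_boot all_order all_algebra.
From mathcomp Require Import all_classical all_reals all_analysis.
From mathcomp Require Import ring lra.
Import Order.TTheory GRing.Theory Num.Theory.
Import numFieldNormedType.Exports.
Local Open Scope classical_set_scope.
Local Open Scope ring_scope.

Local Notation sums_to a l := (series a @ \oo --> l) (only parsing).

(** * Real series *)

Section Series.
Context {R : realType}.
Implicit Types (a b : nat -> R) (l m k : R).

Lemma sums_to_unique {a l m} : sums_to a l -> sums_to a m -> l = m.
Proof. by move=> al am; apply: cvg_unique al am. Qed.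

Lemma eq_sums_to {a b l} : a =1 b -> sums_to a l -> sums_to b l.
Proof. by move=> /funext ->. Qed.

Lemma sums_toD {a b l m} :
  sums_to a l -> sums_to b m -> sums_to (fun n => a n + b n) (l + m).
Proof.
move=> al bm; have -> : series (fun n => a n + b n) = series a \+ series b.
  by apply/funext => N; rewrite /series /= big_split.
exact: cvgD.
Qed.

Lemma sums_toB {a b l m} :
  sums_to a l -> sums_to b m -> sums_to (fun n => a n - b n) (l - m).
Proof.
move=> al bm; have -> : series (fun n => a n - b n) = series a \- series b.
  by apply/funext => N; rewrite /series /= sumrB.
exact: cvgB.
Qed.

Lemma sums_toZ {a l} k : sums_to a l -> sums_to (fun n => k * a n) (k * l).
Proof.
move=> al; have -> : series (fun n => k * a n) = k \*o series a.
  by apply/funext => N; rewrite /series /= mulr_sumr.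
exact: cvgMr.
Qed.

Lemma sums_to_le {a b l m} :
  (forall n, a n <= b n) -> sums_to a l -> sums_to b m -> l <= m.
Proof.
move=> ab al bm; apply: (ler_cvg_to al bm); apply: nearW => N.
exact: ler_sum.
Qed.

Lemma ge0_series_le {a l} N : (forall n, 0 <= a n) -> sums_to a l -> series a N <= l.
Proof.
move=> a0 al; have <- : limn (series a) = l by apply: cvg_lim.
apply: nondecreasing_cvgn_le; last by apply/cvg_ex; exists l.
by apply: nondecreasing_series => n _.
Qed.

(** The differences are nonnegative and sum to zero, and each one is dominated by a partial sum,
    hence by zero. This rigidity later turns equality of values into termwise equality in Young's
    inequality. *)
Lemma sums_to_eq {a b l} :
  (forall n, a n <= b n) -> sums_to a l -> sums_to b l -> a =1 b.
Proof.
move=> ab al bl n; have := sums_toB bl al; rewrite subrr => d0.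
have d_ge0 i : 0 <= b i - a i by rewrite subr_ge0.
apply/eqP; rewrite eq_le ab /= -subr_le0.
apply: le_trans (ge0_series_le n.+1 d_ge0 d0).
by rewrite /series /= big_nat_recr //= lerDr sumr_ge0.
Qed.

Lemma ge0_cvg_series_le {a b} : (forall n, 0 <= a n <= b n) ->
  cvgn (series b) -> cvgn (series a).
Proof.
move=> ab; apply: series_le_cvg => n; have /andP[a0 leab] := ab n => //.
exact: le_trans leab.
Qed.

Lemma sums_to_EFin {a l} :
  sums_to a l -> (\sum_(0 <= n < N) (a n)%:E)%E @[N --> \oo] --> l%:E.
Proof.
move=> al; under eq_fun do rewrite sumEFin.
exact: (cvg_comp _ _ al).
Qed.

Lemma nneseries_sums_to {a l} :
  sums_to a l -> (\sum_(0 <= n <oo) (a n)%:E)%E = l%:E.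
Proof. by move=> al; apply: cvg_lim => //; exact: sums_to_EFin. Qed.

Lemma finite_support_sums_to {a} N :
  (forall n, (N <= n)%N -> a n = 0) -> sums_to a (\sum_(0 <= n < N) a n).
Proof.
move=> a0; apply: cvg_near_cst; exists N => // n /= Nn.
rewrite /series /= (big_cat_nat (n := N)) //= [X in _ + X]big_nat_cond.
by rewrite [X in _ + X]big1 ?addr0// => i /andP[/andP[/a0]].
Qed.

End Series.

(** * Auxiliary facts: a polynomial-exponential bound and the closure of a ray *)

Lemma exprn_le_fact_expR (R : realType) k (x : R) :
  0 <= x -> x ^+ k <= k`!%:R * expR x.
Proof.
move=> x0; case: k => [|k].
  by rewrite expr0 fact0 mul1r (le_trans _ (expR_ge1Dx x))// lerDl.
rewrite mulrC -ler_pdivrMr ?ltr0n ?fact_gt0//.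
by apply: le_trans (expR_ge1Dxn k x0); rewrite lerDr.
Qed.

Lemma closure_ray (R : realType) (b : R) :
  closure `]-oo, b[%classic = `]-oo, b]%classic.
Proof.
apply/seteqP; split.
  rewrite [X in _ `<=` X](_ : _ = [set x | x <= b]); last first.
    by apply/seteqP; split=> x /=; rewrite in_itv.
  rewrite (proj1 (closure_id _) (@closed_le R b)); apply: closureS => x /=.
  by rewrite in_itv /= => /ltW.
move=> x /=; rewrite in_itv /= le_eqVlt => /predU1P[->|xb]; last first.
  by apply: subset_closure; rewrite /= in_itv.
move=> B bB; near b^'- => y; exists y; split.
  by rewrite /= in_itv /=; near: y; exact: nbhs_left_lt.
by near: y; exact: cvg_within bB.
Unshelve. all: by end_near. Qed.

(** * Exponential sums and their moments *)

Section ExponentialSums.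
Context {R : realType}.
Variable sigma : nat -> R.
Hypothesis sigma_gt0 : forall n, 0 < sigma n.
Hypothesis sigma_infty : sigma @ \oo --> +oo.

Definition moment_term (k : nat) (x : R) (n : nat) : R :=
  sigma n ^+ k * expR (sigma n * x).

(* The k-th derivative of the exponential series at x; a junk value where the
   series diverges. *)
Definition moment (k : nat) (x : R) : R := limn (series (moment_term k x)).

Lemma moment_term_gt0 k x n : 0 < moment_term k x n.
Proof. by rewrite mulr_gt0 ?exprn_gt0 ?expR_gt0. Qed.

(** This is [1 + t <= expR t] at [t = sigma n * (y - x)], scaled by the term at [x]. Summed over
    [n], it is the convexity inequality behind monotonicity, continuity, derivatives and
    subgradients below. *)
Lemma moment_term_tangent k x y n :
  (y - x) * moment_term k.+1 x n <= moment_term k y n - moment_term k x n.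
Proof.
have -> : moment_term k y n =
    moment_term k x n * expR (sigma n * (y - x)).
  by rewrite /moment_term -mulrA -expRD; congr (_ * expR _); ring.
have -> : (y - x) * moment_term k.+1 x n =
    moment_term k x n * (sigma n * (y - x)).
  by rewrite /moment_term exprS; ring.
rewrite -[X in _ <= _ - X]mulr1 -mulrBr ler_pM2l ?moment_term_gt0//.
by rewrite lerBrDl expR_ge1Dx.
Qed.

Lemma sums_tangent k x y (l l' d : R) :
  sums_to (moment_term k x) l -> sums_to (moment_term k y) l' ->
  sums_to (moment_term k.+1 x) d -> (y - x) * d <= l' - l.
Proof.
move=> xl yl' xd; apply: sums_to_le (sums_toZ (y - x) xd) (sums_toB yl' xl) => n.
exact: moment_term_tangent.
Qed.

Lemma moment_term_le k x y n : x <= y -> moment_term k x n <= moment_term k y n.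
Proof.
by move=> xy; rewrite ler_pM2l ?exprn_gt0// ler_expR ler_pM2l.
Qed.

Lemma moment_summable k x y : x < y ->
  cvgn (series (moment_term 0 y)) -> cvgn (series (moment_term k x)).
Proof.
move=> xy cy; have d0 : 0 < y - x by rewrite subr_gt0.
(* The factor [sigma n ^+ k] is absorbed by the gap between [x] and [y]: [(sigma n * (y - x)) ^+ k]
   is at most [k!] times [expR (sigma n * (y - x))]. *)
set c := k`!%:R / (y - x) ^+ k.
apply: (@ge0_cvg_series_le _ _ (fun n => c * moment_term 0 y n)); last first.
  by have /cvg_ex[l /(sums_toZ c) yl] := cy; apply/cvg_ex; exists (c * l).
move=> n; rewrite ltW ?moment_term_gt0//=.
have := exprn_le_fact_expR _ k _ (mulr_ge0 (ltW (sigma_gt0 n)) (ltW d0)).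
rewrite /c /moment_term expr0 mul1r mulrAC ler_pdivlMr ?exprn_gt0//.
rewrite exprMn => h; rewrite mulrAC.
have -> : expR (sigma n * y) = expR (sigma n * (y - x)) * expR (sigma n * x).
  by rewrite -expRD; congr expR; ring.
by rewrite mulrA ler_wpM2r ?expR_ge0.
Qed.

(** Divergence to infinity leaves only finitely many terms below 1, and these have a positive
    minimum. *)
Lemma sigma_lbound : exists2 m : R, 0 < m & forall n, m <= sigma n.
Proof.
have fin_lb N : exists2 m : R, 0 < m & forall n, (n < N)%N -> m <= sigma n.
  elim: N => [|N [m m0 mN]]; first by exists 1.
  exists (Num.min m (sigma N)); first by rewrite lt_min m0 /=.
  move=> n; rewrite ltnS leq_eqVlt => /predU1P[->|nN].
    by rewrite ge_min lexx orbT.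
  by rewrite ge_min mN.
have /cvgryPge/(_ 1)[N _ N1] := sigma_infty.
have [m m0 mN] := fin_lb N.
exists (Num.min m 1); first by rewrite lt_min m0 /=.
by move=> n; rewrite ge_min; case: (ltnP n N) => [/mN->//|/N1 /= ->]; rewrite orbT.
Qed.

Lemma moment_summable_pred k x : cvgn (series (moment_term k.+1 x)) ->
  cvgn (series (moment_term k x)).
Proof.
have [m m0 mn] := sigma_lbound => cx.
apply: (@ge0_cvg_series_le _ _ (fun n => m^-1 * moment_term k.+1 x n)); last first.
  by have /cvg_ex[l /(sums_toZ m^-1) yl] := cx; apply/cvg_ex; exists (m^-1 * l).
move=> n; rewrite ltW ?moment_term_gt0//= ler_pdivlMl// /moment_term exprS -mulrA.
by rewrite ler_pM2r// moment_term_gt0.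
Qed.

(** For [x >= 0] every term is at least 1, so the terms cannot tend to 0. *)
Lemma summable_lt0 x : cvgn (series (moment_term 0 x)) -> x < 0.
Proof.
move=> /cvg_series_cvg_0 t0; rewrite ltNge; apply/negP => x0.
suff : (1 : R) <= 0 by rewrite ler10.
rewrite -(cvg_lim _ t0)//; apply: limr_ge; first exact: cvgP t0.
by apply: nearW => n; rewrite /moment_term expr0 mul1r -expR0 ler_expR
  mulr_ge0// ltW.
Qed.

Lemma exp_seriesE x :
  exp_series sigma x = (\sum_(0 <= n <oo) (moment_term 0 x n)%:E)%E.
Proof.
by apply: eq_eseriesr => n _; rewrite /moment_term expr0 mul1r.
Qed.

Lemma exp_series_sums x l :
  sums_to (moment_term 0 x) l -> exp_series sigma x = l%:E.
Proof. by move=> /nneseries_sums_to; rewrite exp_seriesE. Qed.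

Lemma edom_exp_series x :
  edom (exp_series sigma) x <-> cvgn (series (moment_term 0 x)).
Proof.
split=> [fx|/cvg_ex[l /exp_series_sums]]; last first.
  by rewrite /edom /= => ->; rewrite ltry.
apply: nnseries_is_cvg => [n|]; first by rewrite ltW ?moment_term_gt0.
by rewrite -exp_seriesE.
Qed.

(** The summed tangent inequality handles points where the series is finite; elsewhere the right
    side is infinite. Only summability at [x] is assumed, so the endpoint of the domain is covered
    too. *)
Lemma subdiff_exp_series x (l d : R) : sums_to (moment_term 0 x) l ->
  sums_to (moment_term 1 x) d -> subdiff (exp_series sigma) x d.
Proof.
move=> xl xd; have fx := exp_series_sums _ _ xl.
split=> [|y]; first by rewrite /edom /= fx ltry.
rewrite fx.
have [/edom_exp_series/cvg_ex[l' yl']|] := boolP (exp_series sigma y < +oo)%E.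
  rewrite (exp_series_sums _ _ yl') -EFinB lee_fin mulrC.
  exact: sums_tangent xl yl' xd.
by rewrite -leNgt leye_eq => /eqP ->; rewrite leey.
Qed.

(** Finite sums are continuous on the whole line. They transport information to and from the
    endpoint, where the full series may diverge. *)
Lemma partial_moment_continuous N k :
  continuous (fun x => series (moment_term k x) N).
Proof.
move=> x; elim: N => [|N IH].
  rewrite /series /=; under eq_fun do rewrite big_nil; exact: cvg_cst.
rewrite /series /=; under eq_fun do rewrite big_nat_recr //=.
apply: cvgD => //; apply: cvgM; first exact: cvg_cst.
apply: continuous_comp; last exact: continuous_expR.
by apply: cvgM; [exact: cvg_cst|exact: cvg_id].
Qed.

End ExponentialSums.

(** * Regularity of the moments to the left of an endpoint [b] *)

Section Moments.
Context {R : realType}.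
Variables (sigma : nat -> R) (b : R).
Hypothesis sigma_gt0 : forall n, 0 < sigma n.
Hypothesis sigma_infty : sigma @ \oo --> +oo.
Hypothesis summable_ltb : forall x, x < b -> cvgn (series (moment_term sigma 0 x)).

Local Notation moment_term := (moment_term sigma).
Local Notation moment := (moment sigma).

Lemma moment_sums k x : x < b -> sums_to (moment_term k x) (moment k x).
Proof.
move=> xb; have [xy yb] := midf_lt xb.
by have := moment_summable _ sigma_gt0 k _ _ xy (summable_ltb _ yb).
Qed.

Lemma moment_gt0 k x : x < b -> 0 < moment k x.
Proof.
move=> xb; apply: lt_le_trans (ge0_series_le 1 _ (moment_sums k _ xb)) => [|n].
  by rewrite /series /= big_nat1 moment_term_gt0.
by rewrite ltW ?moment_term_gt0.
Qed.

Lemma moment_tangent k x y : x < b -> y < b ->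
  (y - x) * moment k.+1 x <= moment k y - moment k x.
Proof.
by move=> xb yb; apply: (sums_tangent _ sigma_gt0 k); exact: moment_sums.
Qed.

Lemma moment_lt k x y : x < y -> y < b -> moment k x < moment k y.
Proof.
move=> xy yb; have xb := lt_trans xy yb; rewrite -subr_gt0.
apply: lt_le_trans (moment_tangent k _ _ xb yb).
by rewrite mulr_gt0 ?moment_gt0 ?subr_gt0.
Qed.

Lemma moment_le k x y : x <= y -> y < b -> moment k x <= moment k y.
Proof.
by rewrite le_eqVlt => /predU1P[->//|xy yb]; rewrite ltW ?moment_lt.
Qed.

(** The moment is Lipschitz to the left of the midpoint [z] of [x] and [b]: the tangent inequality
    bounds its slopes there by the next moment at [z]. *)
Lemma moment_continuous k x : x < b -> {for x, continuous (moment k)}.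
Proof.
move=> xb; have [xz zb] := midf_lt xb; set z := (x + b) / 2 in xz zb.
have M0 := moment_gt0 k.+1 _ zb; set M := moment k.+1 z in M0.
have lip y y' : y <= y' -> y' <= z -> moment k y' - moment k y <= (y' - y) * M.
  move=> yy' y'z; have y'b := le_lt_trans y'z zb; have yb := le_lt_trans yy' y'b.
  rewrite -lerN2 opprB -mulNr opprB.
  apply: le_trans (moment_tangent k _ _ y'b yb).
  by rewrite ler_wnM2l ?subr_le0// moment_le.
apply/cvgrPdist_le => e e0; near=> y.
have yz : y <= z.
  by near: y; apply: filterS (lt_nbhsl xz) => y /ltW.
have dy : `|x - y| * M <= e.
  rewrite -ler_pdivlMr//; near: y; apply: cvgr_dist_le => //; exact: divr_gt0.
apply: le_trans dy.
have [xy|yx] := leP x y.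
  rewrite ler0_norm ?subr_le0 ?moment_le//; last exact: le_lt_trans zb.
  by rewrite ler0_norm ?subr_le0// !opprB lip.
have yx' := ltW yx; rewrite ger0_norm ?subr_ge0 ?moment_le//.
by rewrite ger0_norm ?subr_ge0 ?lip// ltW.
Unshelve. all: by end_near. Qed.

Lemma moment_arbitrarily_small k e : 0 < e -> exists2 x, x < b & moment k x < e.
Proof.
move=> e0; have [m m0 lem] := sigma_lbound _ sigma_gt0 sigma_infty.
pose y := b - 1; have yb : y < b by rewrite gtrBl.
(* Since the next moment is at least [m * moment k], the tangent inequality at [y - t] gives
   [t * m * moment k (y - t) < moment k y]; this [t] makes the resulting bound equal to [e]. *)
pose t := moment k y / (m * e).
have t0 : 0 < t by rewrite divr_gt0 ?moment_gt0// mulr_gt0.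
have xy : y - t < y by rewrite gtrBl.
have xb := lt_trans xy yb.
exists (y - t) => //; have := moment_tangent k _ _ xb yb.
rewrite opprB addrCA subrr addr0 => tangent.
have mk : m * moment k (y - t) <= moment k.+1 (y - t).
  apply: sums_to_le (sums_toZ m (moment_sums k _ xb)) (moment_sums k.+1 _ xb) => n.
  by rewrite /moment_term exprS -mulrA ler_wpM2r// ltW ?moment_term_gt0.
have : t * (m * moment k (y - t)) < moment k y.
  apply: le_lt_trans (_ : moment k y - moment k (y - t) < _); last first.
    by rewrite gtrBl moment_gt0.
  by apply: le_trans tangent; rewrite ler_pM2l.
have -> : t * (m * moment k (y - t)) = moment k y * (moment k (y - t) / e).
  by rewrite /t; field; rewrite !gt_eqF.
by rewrite gtr_pMr ?moment_gt0// ltr_pdivrMr// mul1r.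
Qed.

(** Intermediate values between a far left point and a point close to [b]. The upper bound on [u] is
    a partial sum at [b], so that convergent and divergent series at [b] are treated alike. *)
Lemma moment_surjective k u N : 0 < u -> u < series (moment_term k b) N ->
  exists2 x, x < b & moment k x = u.
Proof.
move=> u0 uN.
have [x xb xu] := moment_arbitrarily_small k _ u0.
have [y yb uy] : exists2 y, y < b & u < moment k y.
  have : \forall y \near b^'-, u < series (moment_term k y) N.
    apply: (@cvgr_gt _ _ _ _ _ _ _ u uN).
    apply: cvg_at_left_filter; exact: (partial_moment_continuous sigma).
  move=> near_u; near b^'- => y; exists y => //.
  apply: lt_le_trans (ge0_series_le N _ (moment_sums k _ _)) => //.
  - by near: y.
  - by move=> n; rewrite ltW ?moment_term_gt0.
have xy : x <= y.
  rewrite leNgt; apply/negP => /moment_lt/(_ xb) lt_yx.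
  by have := lt_trans uy (lt_trans (lt_yx k) xu); rewrite ltxx.
have [] := @IVT _ (moment k) x y u xy.
- apply: continuous_in_subspaceT => z; rewrite inE /= in_itv /= => /andP[_ zy].
  apply: moment_continuous; exact: le_lt_trans yb.
- by rewrite ge_min (ltW xu) le_max (ltW uy) orbT.
move=> z; rewrite in_itv /= => /andP[_ zy] zu; exists z => //.
exact: le_lt_trans yb.
Unshelve. all: by end_near. Qed.

Lemma exp_series_moment x : x < b -> exp_series sigma x = (moment 0 x)%:E.
Proof. by move=> xb; apply: exp_series_sums; exact: moment_sums. Qed.

Lemma is_derive_exp_series x : x < b ->
  is_derive x 1 (fine \o exp_series sigma) (moment 1 x).
Proof.
move=> xb; apply: (@near_eq_is_derive _ _ _ (moment 0)).
  by near=> y; rewrite /= exp_series_moment//; near: y; exact: lt_nbhsl.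
suff cvg_quotient : h^-1 *: ((moment 0 \o shift x) (h *: 1) - moment 0 x)
    @[h --> 0^'] --> moment 1 x.
  by split; [exact: cvgP cvg_quotient|exact: cvg_lim cvg_quotient].
have shift_cvg : h + x @[h --> 0^'] --> x.
  apply: cvg_trans (_ : h + x @[h --> 0] --> x); last first.
    by rewrite -[X in _ --> X]add0r; apply: cvgD; [exact: cvg_id|exact: cvg_cst].
  by apply: cvg_app; exact: nbhs_dnbhs.
apply/cvgrPdist_le => e e0; near=> h.
have h0 : h != 0 by near: h; exact: nbhs_dnbhs_neq.
have hb : h + x < b.
  by near: h; exact: (cvgr_lt _ shift_cvg).
(* The difference quotient lies between [moment 1 x] and [moment 1 (h + x)], by the tangent
   inequalities at both points, so this bound suffices. The sign of [h] only decides the order of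
   the two. *)
have : `|moment 1 x - moment 1 (h + x)| <= e.
  near: h; apply: cvgr_dist_le => //.
  exact: (cvg_comp _ _ shift_cvg (moment_continuous 1 _ xb)).
apply: le_trans; rewrite /= [h%:A]mulr1 [_ *: _]mulrC.
have := moment_tangent 0 _ _ hb xb; have := moment_tangent 0 _ _ xb hb.
set D := moment 0 (h + x) - moment 0 x.
rewrite -[moment 0 x - _]opprB -/D opprD addrCA subrr addr0 addrK mulNr lerN2.
have [h_lt0|h_gt0|h_eq0] := ltgtP h 0; last by rewrite h_eq0 eqxx in h0.
  rewrite ![h * _]mulrC -(ler_ndivrMr _ _ h_lt0) -(ler_ndivlMr _ _ h_lt0) => qA Bq.
  by rewrite !ger0_norm ?subr_ge0//; lra.
rewrite ![h * _]mulrC -(ler_pdivlMr _ _ h_gt0) -(ler_pdivrMr _ _ h_gt0) => Aq qB.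
by rewrite !ler0_norm ?subr_le0//; lra.
Unshelve. all: by end_near. Qed.

(** Monotonicity gives the upper bound [c]. For the lower bound, some partial sum at [b] exceeds
    [c - e], and continuity of that finite sum keeps it so slightly to the left. *)
Lemma moment1_cvg_left (c : R) :
  sums_to (moment_term 1 b) c -> moment 1 @ b^'- --> c.
Proof.
move=> bc; apply/cvgrPdist_le => e e0.
have [N _ /(_ N (leqnn N)) cN] :
    \forall N \near \oo, c - e < series (moment_term 1 b) N.
  by apply: (cvgr_gt _ bc); rewrite gtrBl.
near=> y; have yb : y < b by near: y; exact: nbhs_left_lt.
have yc : moment 1 y <= c.
  apply: sums_to_le (moment_sums 1 _ yb) bc => n.
  by apply: moment_term_le => //; exact: ltW.
rewrite ger0_norm ?subr_ge0// lerBlDl -lerBlDr.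
apply: le_trans (ge0_series_le N _ (moment_sums 1 _ yb)); last first.
  by move=> n; rewrite ltW ?moment_term_gt0.
apply: ltW; near: y; apply: cvgr_gt cN.
apply: cvg_at_left_filter; exact: (partial_moment_continuous sigma).
Unshelve. all: by end_near. Qed.

(** Tangent inequalities at [y] and at [b] squeeze the quotient between [moment 1 y] and [c]. *)
Lemma left_derivative_exp_series (l c : R) :
  sums_to (moment_term 0 b) l -> sums_to (moment_term 1 b) c ->
  has_left_derivative (exp_series sigma) b c%:E.
Proof.
move=> bl bc; rewrite /has_left_derivative (exp_series_sums _ _ _ bl); split=> //.
apply: cvg_trans (_ : ((moment 0 y - l) / (y - b))%:E @[y --> b^'-] --> c%:E).
  apply: near_eq_cvg; apply: filterS (nbhs_left_lt b) => y yb.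
  by rewrite exp_series_moment.
suff cvg_quotient : (moment 0 y - l) / (y - b) @[y --> b^'-] --> c.
  exact: (cvg_comp _ _ cvg_quotient).
apply: squeeze_cvgr (moment1_cvg_left _ bc) (cvg_cst _).
near=> y; have yb : y < b by near: y; exact: nbhs_left_lt.
have yb0 : y - b < 0 by rewrite subr_lt0.
have ym k := moment_sums k _ yb.
rewrite ler_ndivlMr// ler_ndivrMr//.
have := sums_tangent _ sigma_gt0 _ _ _ _ _ _ (ym 0) bl (ym 1).
have := sums_tangent _ sigma_gt0 _ _ _ _ _ _ bl (ym 0) bc.
by lra.
Unshelve. all: by end_near. Qed.

(** A subgradient satisfies [u * (y - x) <= (y - x) * moment 1 y]. Dividing by [y - x] and letting
    [y] tend to [x] from either side gives both inequalities, by continuity of [moment 1]. *)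
Lemma subdiff_exp_series_unique x u : x < b ->
  subdiff (exp_series sigma) x u -> u = moment 1 x.
Proof.
move=> xb [_ uP]; have c1 := moment_continuous 1 _ xb.
have u_tangent y : y < b -> u * (y - x) <= (y - x) * moment 1 y.
  move=> yb; have := uP y; rewrite !exp_series_moment// lee_fin => uy.
  by have := moment_tangent 0 _ _ yb xb; lra.
apply/eqP; rewrite eq_le; apply/andP; split.
  have c1r := cvg_at_right_filter c1.
  rewrite -(cvg_lim _ c1r)//; apply: limr_ge; first exact: cvgP c1r.
  near=> y; have xy : 0 < y - x by rewrite subr_gt0; near: y; exact: nbhs_right_gt.
  by rewrite -(ler_pM2l xy) mulrC u_tangent//; near: y; exact: nbhs_right_lt.
have c1l := cvg_at_left_filter c1.
rewrite -(cvg_lim _ c1l)//; apply: limr_le; first exact: cvgP c1l.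
near=> y; have xy : y - x < 0 by rewrite subr_lt0; near: y; exact: nbhs_left_lt.
rewrite -(ler_nM2l xy) mulrC u_tangent//; apply: lt_trans xb.
by near: y; exact: nbhs_left_lt.
Unshelve. all: by end_near. Qed.

End Moments.

(** * Conjugates and duality *)

Section Conjugates.
Context {R : realType}.
Implicit Types (x y u v w : R).

(** For positive [v], write [expR y] as [v * expR (y - ln v)] and use [1 + t <= expR t]. *)
Lemma young_expR v y : 0 <= v -> y * v - expR y <= v * (ln v - 1).
Proof.
rewrite le_eqVlt => /predU1P[<-|v0].
  by rewrite mulr0 mul0r sub0r oppr_le0 expR_ge0.
have -> : expR y = v * expR (y - ln v).
  by rewrite expRD expRN lnK ?posrE// mulrCA divff ?mulr1 ?gt_eqF.
have := expR_ge1Dx (y - ln v); rewrite -(ler_pM2l v0); lra.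
Qed.

(** The inequality [1 + t < expR t] is strict unless [t = y - ln v] vanishes; [v = 0] is excluded
    because [expR y] is positive. *)
Lemma young_expR_eq v y : 0 <= v -> y * v - expR y = v * (ln v - 1) -> v = expR y.
Proof.
rewrite le_eqVlt => /predU1P[<-|v0].
  rewrite mulr0 mul0r sub0r => /eqP; rewrite oppr_eq0 => /eqP y0.
  by have := expR_gt0 y; rewrite y0 ltxx.
move=> eqv; suff <- : ln v = y by rewrite lnK.
apply/eqP/negPn/negP => vy; have : y - ln v != 0 by rewrite subr_eq0 eq_sym.
move=> /expR_gt1Dx; rewrite -(ltr_pM2l v0).
have -> : v * expR (y - ln v) = expR y.
  by rewrite expRD expRN lnK ?posrE// mulrCA divff ?mulr1 ?gt_eqF.
lra.
Qed.

Lemma young_expR_attained y : y * expR y - expR y = expR y * (ln (expR y) - 1).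
Proof. by rewrite expRK mulrBr mulr1 mulrC. Qed.

Lemma fconj_ge (g : R -> \bar R) x u : ((x * u)%:E - g x <= fconj g u)%E.
Proof. by apply: ereal_sup_ubound; exists x. Qed.

Lemma fconj_le (g : R -> \bar R) u (M : \bar R) :
  (forall x, ((x * u)%:E - g x <= M)%E) -> (fconj g u <= M)%E.
Proof. by move=> gM; apply: ge_ereal_sup => _ [x _ <-]. Qed.

Lemma fconj_lt0 (g : R -> \bar R) x C u :
  (forall y, y <= x -> (g y <= C%:E)%E) -> u < 0 -> fconj g u = +oo%E.
Proof.
move=> gC u0; apply/eqyP => A _.
(* Moving left by [t] raises the linear term by the absolute value in the numerator, enough for the
   supremum to reach the arbitrary level [A]. *)
pose t := `|A - x * u + C| / - u.
have t0 : 0 <= t by rewrite divr_ge0// oppr_ge0 ltW.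
apply: le_trans (fconj_ge g (x - t) u).
apply: (@le_trans _ _ (((x - t) * u)%:E - C%:E)%E); last first.
  by rewrite leeB// gC// gerBl.
rewrite -EFinB lee_fin mulrBl.
have -> : t * u = - `|A - x * u + C| by rewrite /t; field; rewrite lt_eqF.
have := ler_norm (A - x * u + C); lra.
Qed.

Lemma fconj_exp_term_lt0 (sigma : nat -> R) n u : 0 < sigma n -> u < 0 ->
  fconj (exp_term sigma n) u = +oo%E.
Proof.
move=> s0; apply: (@fconj_lt0 _ 0 1) => y y0.
by rewrite /exp_term lee_fin expR_le1 pmulr_rle0.
Qed.

Lemma fconj_exp_term (sigma : nat -> R) n v : 0 < sigma n -> 0 <= v ->
  fconj (exp_term sigma n) (sigma n * v) = (v * (ln v - 1))%:E.
Proof.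
move=> s0 v0; apply/eqP; rewrite eq_le; apply/andP; split.
  apply: fconj_le => x; rewrite /exp_term -EFinB lee_fin.
  by have := young_expR _ (sigma n * x) v0; rewrite -mulrA mulrCA.
have ge_expR y : ((y * v - expR y)%:E <= fconj (exp_term sigma n) (sigma n * v))%E.
  apply: le_trans (fconj_ge _ (y / sigma n) _).
  rewrite /exp_term -EFinB lee_fin mulrA divfK ?gt_eqF//.
  by rewrite mulrCA divff ?mulr1 ?gt_eqF.
(* For [v > 0] the supremum is attained at [y = ln v]. For [v = 0] it is only approached, as
   [y = ln e] goes to minus infinity. *)
have /predU1P[v_eq0|v_gt0] : (0 == v) || (0 < v) by rewrite -le_eqVlt.
  rewrite -v_eq0 mul0r; apply/lee_addgt0Pr => e e0.
  have := ge_expR (ln e); rewrite -v_eq0 mulr0 sub0r lnK ?posrE//.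
  by rewrite mulr0 => /(leeD2r e%:E); rewrite -EFinD addNr.
by have := ge_expR (ln v); rewrite lnK ?posrE// mulrBr mulr1 mulrC.
Qed.

Lemma edom_fconj_exp_term (sigma : nat -> R) n u : 0 < sigma n ->
  edom (fconj (exp_term sigma n)) u <-> 0 <= u.
Proof.
move=> s0; rewrite /edom /=; case: (leP 0 u) => [u0|u0].
  have -> : u = sigma n * (u / sigma n) by rewrite mulrC divfK ?gt_eqF.
  by rewrite fconj_exp_term// ?ltry// divr_ge0// ltW.
by rewrite fconj_exp_term_lt0// ltxx.
Qed.

End Conjugates.

(** * Weak duality and its equality case *)

Section Duality.
Context {R : realType}.
Variable sigma : nat -> R.
Hypothesis sigma_gt0 : forall n, 0 < sigma n.
Hypothesis sigma_infty : sigma @ \oo --> +oo.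
Hypothesis domf_neq0 : edom (exp_series sigma) !=set0.

Local Notation f := (exp_series sigma).
Local Notation moment_term := (moment_term sigma).

Definition entropy_term (v : nat -> R) (n : nat) : R := v n * (ln (v n) - 1).

(* By Young's inequality the terms exceed those of a convergent series; the
   excess is summable because v is bounded by u / inf sigma. *)
Lemma entropy_feasible_summable u v : entropy_feasible sigma u v ->
  exists L : R, sums_to (entropy_term v) L.
Proof.
move=> [v0 vu].
have [x0 /(edom_exp_series _ sigma_gt0)/cvg_ex[/= l x0l]] := domf_neq0.
have [m m0 lem] := sigma_lbound _ sigma_gt0 sigma_infty.
have sv0 n : 0 <= sigma n * v n by rewrite mulr_ge0// ltW.
pose excess n := entropy_term v n - x0 * (sigma n * v n) + moment_term 0 x0 n.
have [e exc_e] : exists e : R, sums_to excess e.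
  apply/cvg_ex.
  (* Here [ln (v n) - 1 <= v n] and [v n <= u / m], so an entropy term is at most the square of
     [v n], hence at most [u / m] times [sigma n * v n / m]. *)
  pose bound n := (u / m / m - x0) * (sigma n * v n) + moment_term 0 x0 n.
  apply: (@ge0_cvg_series_le _ _ bound); last first.
    by apply/cvg_ex; eexists; exact: sums_toD (sums_toZ _ vu) x0l.
  move=> n; rewrite /excess /bound /moment_term expr0 mul1r; apply/andP; split.
    by have := young_expR _ (sigma n * x0) (v0 n); rewrite /entropy_term; lra.
  rewrite lerD2r mulrBl lerD2r.
  have le_m : v n <= sigma n * v n / m.
    by rewrite ler_pdivlMr// mulrC ler_wpM2r.
  have le_u : sigma n * v n <= u.
    apply: le_trans (ge0_series_le n.+1 sv0 vu).
    by rewrite /series /= big_nat_recr //= lerDr sumr_ge0.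
  have le_um : v n <= u / m by apply: le_trans le_m _; rewrite ler_pM2r ?invr_gt0.
  have ln_le : ln (v n) - 1 <= v n.
    have := expR_ge1Dx (ln (v n)); move: (v0 n).
    rewrite le_eqVlt => /predU1P[<- _|vn0].
      by rewrite ln0// sub0r oppr_le0.
    by rewrite lnK ?posrE//; lra.
  apply: le_trans (_ : v n * v n <= _); first by rewrite /entropy_term ler_wpM2l.
  have -> : u / m / m * (sigma n * v n) = (u / m) * (sigma n * v n / m) by ring.
  exact: ler_pM.
exists (e + x0 * u - l).
apply: eq_sums_to (sums_toB (sums_toD exc_e (sums_toZ x0 vu)) x0l) => n.
by rewrite /excess; ring.
Qed.

Lemma entropy_objectiveE v (L : R) :
  sums_to (entropy_term v) L -> entropy_objective v = L%:E.
Proof. by move=> vL; rewrite -(nneseries_sums_to vL). Qed.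

Lemma weak_duality u v x (L l : R) : entropy_feasible sigma u v ->
  sums_to (entropy_term v) L -> sums_to (moment_term 0 x) l -> x * u - l <= L.
Proof.
move=> [v0 vu] vL xl; apply: sums_to_le (sums_toB (sums_toZ x vu) xl) vL => n.
rewrite /moment_term expr0 mul1r mulrA [x * _]mulrC.
exact: young_expR.
Qed.

Lemma strong_duality_eq u v x (l : R) : entropy_feasible sigma u v ->
  sums_to (entropy_term v) (x * u - l) -> sums_to (moment_term 0 x) l ->
  v = moment_term 0 x.
Proof.
move=> [v0 vu] vL xl; apply/funext => n.
have young n' : x * (sigma n' * v n') - moment_term 0 x n' <= entropy_term v n'.
  by rewrite /moment_term expr0 mul1r mulrA [x * _]mulrC; exact: young_expR.
have := sums_to_eq young (sums_toB (sums_toZ x vu) xl) vL n.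
rewrite /moment_term expr0 mul1r mulrA [x * _]mulrC.
exact: young_expR_eq.
Qed.

Lemma fconj_exp_series_ge x u (l : R) : sums_to (moment_term 0 x) l ->
  ((x * u - l)%:E <= fconj f u)%E.
Proof.
move=> /exp_series_sums fx; apply: le_trans (fconj_ge _ x u).
by rewrite fx EFinB.
Qed.

Lemma fconj_exp_series_le u (M : R) :
  (forall x (l : R), sums_to (moment_term 0 x) l -> x * u - l <= M) ->
  (fconj f u <= M%:E)%E.
Proof.
move=> leM; apply: fconj_le => x.
have [/(edom_exp_series _ sigma_gt0)/cvg_ex[l xl]|] := boolP (f x < +oo)%E.
  by rewrite (exp_series_sums _ _ _ xl) -EFinB lee_fin leM.
by rewrite -leNgt leye_eq => /eqP ->; rewrite addeNy leNye.
Qed.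

Lemma fconj_le_entropy u v : entropy_feasible sigma u v ->
  (fconj f u <= entropy_objective v)%E.
Proof.
move=> vu; have [L vL] := entropy_feasible_summable _ _ vu.
rewrite (entropy_objectiveE _ _ vL); apply: fconj_exp_series_le => x l xl.
exact: weak_duality vu vL xl.
Qed.

(** Young's inequality is an equality along this sequence, so its value [x * u - l] meets the lower
    bound. Stated through convergence at [x], it serves both interior points and the endpoint. *)
Lemma is_min_at_moment_term x (l u : R) :
  sums_to (moment_term 0 x) l -> sums_to (moment_term 1 x) u ->
  is_min_at (entropy_feasible sigma u) entropy_objective (fconj f u)
    (fun n => expR (sigma n * x)) .
Proof.
move=> xl xu; set v := fun n => _.
have vE : moment_term 0 x = v by apply/funext => n; rewrite /moment_term expr0 mul1r.
have vu : entropy_feasible sigma u v.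
  by split=> [n|]; [exact: expR_ge0|exact: xu].
have vL : sums_to (entropy_term v) (x * u - l).
  apply: eq_sums_to (sums_toB (sums_toZ x xu) xl) => n.
  by rewrite /entropy_term -young_expR_attained /moment_term expr0 expr1; ring.
have obj : entropy_objective v = fconj f u.
  apply/eqP; rewrite eq_le fconj_le_entropy// (entropy_objectiveE _ _ vL).
  by rewrite fconj_exp_series_ge.
split=> //; apply/eqP; rewrite eq_le; apply/andP; split.
  by apply: le_ereal_inf_tmp => _ [w wu <-]; exact: fconj_le_entropy.
by rewrite -obj; apply: ereal_inf_lbound; exists v.
Qed.

End Duality.

(** * Change of variables between conjugate sums and entropy sums *)

Section ConjugateSums.
Context {R : realType}.
Variable sigma : nat -> R.
Hypothesis sigma_gt0 : forall n, 0 < sigma n.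

Local Notation f_ := (exp_term sigma).

Lemma conj_feasible_entropy u v : conj_feasible f_ u v <->
  entropy_feasible sigma u (fun n => v n / sigma n).
Proof.
have scaleK n : sigma n * (v n / sigma n) = v n by rewrite mulrC divfK ?gt_eqF.
split=> -[v0 vu]; (split=> [n|]; last by apply: eq_sums_to vu => n).
  apply: divr_ge0; last exact: ltW.
  exact/(edom_fconj_exp_term _ _ _ (sigma_gt0 n)).
by apply/edom_fconj_exp_term => //; rewrite -scaleK mulr_ge0// ltW.
Qed.

Lemma conj_partial_entropy u v : conj_feasible f_ u v ->
  conj_partial f_ v = entropy_partial (fun n => v n / sigma n).
Proof.
move=> /conj_feasible_entropy[v0 _]; apply/funext => N; apply: eq_bigr => n _.
by rewrite -(fconj_exp_term sigma n)// mulrC divfK ?gt_eqF.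
Qed.

(** The scaling [w n = sigma n * v n] matches feasible sequences and their values. Equality of the
    value sets transfers infima and attainment at once. *)
Lemma conj_image_entropy u :
  [set conj_objective f_ v | v in conj_feasible f_ u] =
  [set entropy_objective w | w in entropy_feasible sigma u].
Proof.
apply/seteqP; split=> _ [v vu <-].
  exists (fun n => v n / sigma n); first exact/conj_feasible_entropy.
  by rewrite /conj_objective (conj_partial_entropy _ _ vu).
pose w n := sigma n * v n.
have wE : (fun n => w n / sigma n) = v.
  by apply/funext => n; rewrite /w mulrC mulKf ?gt_eqF.
have wu : conj_feasible f_ u w by apply/conj_feasible_entropy; rewrite wE.
by exists w => //; rewrite /conj_objective (conj_partial_entropy _ _ wu) wE.
Qed.

Lemma is_minE {X : Type} (F : set X) (phi : X -> \bar R) m :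
  is_min F phi m <->
  [set phi w | w in F] m /\ m = ereal_inf [set phi w | w in F].
Proof.
by split=> [[v [Fv <- inf_v]]|[[v Fv <-] inf_v]]; [split=> //|]; exists v.
Qed.

Lemma is_min_conj_entropy u m :
  is_min (conj_feasible f_ u) (conj_objective f_) m <->
  is_min (entropy_feasible sigma u) entropy_objective m.
Proof. by rewrite !is_minE conj_image_entropy. Qed.

End ConjugateSums.

(** * Values of [u] beyond the first moment at the endpoint *)

Section Endpoint.
Context {R : realType}.
Variables (sigma : nat -> R) (b : R).
Hypothesis sigma_gt0 : forall n, 0 < sigma n.
Hypothesis sigma_infty : sigma @ \oo --> +oo.
Hypothesis summable_ltb : forall x, x < b -> cvgn (series (moment_term sigma 0 x)).
Hypothesis summable_leb : forall x, cvgn (series (moment_term sigma 0 x)) -> x <= b.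

Local Notation f := (exp_series sigma).
Local Notation moment_term := (moment_term sigma).
Local Notation moment := (moment sigma).
Local Notation entropy_inf u :=
  (ereal_inf [set entropy_objective v | v in entropy_feasible sigma u]).

Lemma domf_neq0 : edom f !=set0.
Proof.
exists (b - 1); apply/edom_exp_series => //; apply: summable_ltb.
by rewrite gtrBl.
Qed.

Lemma entropy_feasible_neq0 u : 0 <= u -> entropy_feasible sigma u !=set0.
Proof.
move=> u0; exists (fun n => if n == 0%N then u / sigma 0%N else 0); split=> [n|].
  by case: ifP => // _; rewrite divr_ge0// ltW.
set v := fun n => _; rewrite -[in X in _ --> X](_ : \sum_(0 <= n < 1) v n = u).
  by apply: finite_support_sums_to => -[|n]//= _; rewrite /v mulr0.
by rewrite big_nat1 /v /= mulrC divfK ?gt_eqF.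
Qed.

Lemma series_moment_nondecreasing k x :
  {homo series (moment_term k x) : m n / (m <= n)%N >-> m <= n}.
Proof. by apply: nondecreasing_series => n _ _; rewrite ltW ?moment_term_gt0. Qed.

Lemma series_moment_unbounded k x A : ~ cvgn (series (moment_term k x)) ->
  exists N, A < series (moment_term k x) N.
Proof.
move=> /(nondecreasing_dvgn_lt (series_moment_nondecreasing k x)) /cvgryPgt/(_ A).
by move=> [N _ /(_ N (leqnn N))]; exists N.
Qed.

(* The witness is the optimal sequence of the problem truncated to N terms. *)
Lemma entropy_truncated u (c x : R) M : sums_to (moment_term 1 b) c ->
  c < u -> b < x -> exists2 v, entropy_feasible sigma u v &
    (entropy_objective v <= (x * u - series (moment_term 0 b) M)%:E)%E.
Proof.
move=> bc cu bx.
have c0 : 0 <= c.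
  apply: le_trans (ge0_series_le 0 _ bc); first by rewrite /series /= big_nil.
  by move=> n; rewrite ltW ?moment_term_gt0.
(* To the right of [b] the series diverges, and so does its first moment. *)
have [N0 uN0] : exists N, u < series (moment_term 1 x) N.
  apply: series_moment_unbounded => /(moment_summable_pred _ sigma_gt0 sigma_infty).
  by move=> /summable_leb; rewrite leNgt bx.
pose N := maxn M N0.
have uN : u < series (moment_term 1 x) N.
  apply: lt_le_trans uN0 (series_moment_nondecreasing _ _ _ _ _).
  exact: leq_maxr.
have Nu : series (moment_term 1 b) N < u.
  apply: le_lt_trans cu; apply: ge0_series_le bc => n.
  by rewrite ltW ?moment_term_gt0.
(* The truncated first moment is below [u] at [b] and above [u] at [x]; a crossing point [y] is the
   multiplier of the truncated problem. *)
have [] := @IVT _ (fun y => series (moment_term 1 y) N) b x u (ltW bx).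
- by apply: continuous_subspaceT; exact: (partial_moment_continuous sigma).
- by rewrite ge_min (ltW Nu) le_max (ltW uN) orbT.
move=> y; rewrite in_itv /= => /andP[le_by yx] yu.
pose v n := if (n < N)%N then moment_term 0 y n else 0.
exists v.
  split=> [n|]; first by rewrite /v; case: ifP => // _; rewrite ltW ?moment_term_gt0.
  rewrite -yu; have -> : series (moment_term 1 y) N =
    \sum_(0 <= n < N) sigma n * v n.
    apply: eq_big_nat => n /andP[_ nN].
    by rewrite /v nN /moment_term expr0 mul1r expr1.
  apply: finite_support_sums_to => n.
  by rewrite leqNgt /v => /negbTE ->; rewrite mulr0.
have vL : sums_to (entropy_term v) (y * u - series (moment_term 0 y) N).
  have -> : y * u - series (moment_term 0 y) N = \sum_(0 <= n < N) entropy_term v n.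
    rewrite -yu /series /= mulr_sumr -sumrB; apply: eq_big_nat => n /andP[_ nN].
    rewrite /entropy_term /v nN /moment_term expr0 mul1r -young_expR_attained expr1.
    by ring.
  apply: finite_support_sums_to => n; rewrite leqNgt /entropy_term /v => /negbTE ->.
  by rewrite mul0r.
rewrite (entropy_objectiveE _ _ vL) lee_fin lerB//.
  by rewrite ler_wpM2r// ltW// (le_lt_trans c0).
apply: le_trans (series_moment_nondecreasing 0 b M N (leq_maxl _ _)) _.
by apply: ler_sum => n _; exact: moment_term_le.
Qed.

Lemma entropy_inf_le_beyond u (c l : R) :
  sums_to (moment_term 0 b) l -> sums_to (moment_term 1 b) c -> 0 < u -> c < u ->
  (entropy_inf u <= (b * u - l)%:E)%E.
Proof.
move=> bl bc u0 cu; apply/lee_addgt0Pr => e e0.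
have e20 : 0 < e / 2 by rewrite divr_gt0.
have [M _ /(_ M (leqnn M)) lM] :
    \forall M \near \oo, l - e / 2 < series (moment_term 0 b) M.
  by apply: (cvgr_gt _ bl); rewrite gtrBl.
(* Half of [e] pays for the tail of [l] beyond [M]; this shift of [b] costs exactly the other half
   once multiplied by [u]. *)
have bx : b < b + e / 2 / u by rewrite ltrDl divr_gt0.
have [v vu le_v] := entropy_truncated u c _ M bc cu bx.
apply: le_trans (le_trans _ le_v) _; first by apply: ereal_inf_lbound; exists v.
by rewrite -EFinD lee_fin mulrDl divfK ?gt_eqF//; lra.
Qed.

(** The domain lies left of [b], so the tangent at [b] with slope [c <= u] shows that [x * u - f(x)]
    is largest at [b]. *)
Lemma fconj_le_beyond u (c l : R) :
  sums_to (moment_term 0 b) l -> sums_to (moment_term 1 b) c -> c <= u ->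
  (fconj f u <= (b * u - l)%:E)%E.
Proof.
move=> bl bc cu; apply: fconj_exp_series_le => // x l' xl'.
have xb : x <= b by apply: summable_leb; exact: cvgP xl'.
have := sums_tangent _ sigma_gt0 _ _ _ _ _ _ bl xl' bc.
have : 0 <= (u - c) * (b - x) by rewrite mulr_ge0 ?subr_ge0.
by lra.
Qed.

(** The optimal value is [b * u - l], so the equality case at [b] forces [v] to be the exponential
    sequence there, whose constraint sum is [c]. *)
Lemma entropy_min_beyond u v (c : R) : sums_to (moment_term 1 b) c -> c <= u ->
  entropy_feasible sigma u v -> entropy_objective v = fconj f u -> u = c.
Proof.
move=> bc cu vu vmin.
have /cvg_ex[/= l bl] := moment_summable_pred _ sigma_gt0 sigma_infty 0 _ (cvgP _ bc).
have [L vL] := entropy_feasible_summable _ sigma_gt0 sigma_infty domf_neq0 _ _ vu.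
have LE : L = b * u - l.
  apply/eqP; rewrite eq_le -!lee_fin -(entropy_objectiveE _ _ vL) vmin.
  by rewrite (fconj_le_beyond _ _ _ bl bc cu) fconj_exp_series_ge.
rewrite LE in vL; have vE := strong_duality_eq _ _ _ _ _ vu vL bl.
apply: (sums_to_unique _ bc); case: vu => _; apply: eq_sums_to => n.
by rewrite vE /moment_term expr0 mul1r expr1.
Qed.

End Endpoint.

(** * The ray of convergence and the assembly of the results *)

Lemma edom_exp_series_ray (R : realType) (sigma : nat -> R) :
  (forall n, 0 < sigma n) -> edom (exp_series sigma) !=set0 ->
  exists alpha : R, 0 <= alpha /\
    `]-oo, - alpha[%classic `<=` edom (exp_series sigma) /\
    edom (exp_series sigma) `<=` closure `]-oo, - alpha[%classic.
Proof.
move=> sigma_gt0 D0; set D := edom _ in D0 *.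
have D_lt0 : ubound D 0.
  by move=> x /(edom_exp_series _ sigma_gt0)/(summable_lt0 _ sigma_gt0)/ltW.
have supD : has_sup D by split=> //; exists 0.
(* The endpoint is the supremum of the domain: any smaller [x] has a domain point above it, and
   summability passes to the left. *)
exists (- sup D); rewrite oppr_ge0 opprK closure_ray; split; first exact: ge_sup.
split=> x /=; rewrite in_itv /=; last by move=> Dx; apply: sup_upper_bound.
move=> xD; have [|y Dy] := @sup_adherent _ D (sup D - x) _ supD.
  by rewrite subr_gt0.
rewrite subKr => xy; apply/edom_exp_series => //.
exact/(moment_summable _ sigma_gt0 0 _ _ xy)/edom_exp_series.
Qed.

Theorem proposition17 (R : realType) (sigma : nat -> R)
  (sigma_gt0 : forall n, 0 < sigma n)
  (sigma_infty : sigma @ \oo --> +oo)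
  (domf_neq0 : edom (exp_series sigma) !=set0) :
  let f_ := exp_term sigma in
  let f := exp_series sigma in
  let conj_inf u :=
    ereal_inf [set conj_objective f_ v | v in conj_feasible f_ u] in
  let entropy_inf u :=
    ereal_inf [set entropy_objective v | v in entropy_feasible sigma u] in
  (* existence of alpha *)
  (exists alpha : R, 0 <= alpha /\
     `]-oo, - alpha[%classic `<=` edom f /\
     edom f `<=` closure `]-oo, - alpha[%classic) /\
  (* the objective sums are limits in ]-oo, +oo] *)
  (forall (u : R) (v : nat -> R), conj_feasible f_ u v ->
     cvgn (conj_partial f_ v) /\ (-oo < conj_objective f_ v)%E) /\
  (forall (u : R) (v : nat -> R), entropy_feasible sigma u v ->
     cvgn (entropy_partial v) /\ (-oo < entropy_objective v)%E) /\
  forall alpha : R, 0 <= alpha ->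
  let I : set R := `]-oo, - alpha[%classic in
  I `<=` edom f -> edom f `<=` closure I ->
  let gamma : \bar R :=
    (\sum_(0 <= n <oo) (sigma n * expR (- sigma n * alpha))%:E)%E in
  (* (i) *)
  ((0 <= gamma)%E /\
   subdiff_image f (interior (edom f)) =
     [set u : R | 0 < u /\ (u%:E < gamma)%E] /\
   edom (fconj f) = `[0, +oo[%classic /\
   (forall u : R, 0 <= u ->
      (fconj f u <= conj_inf u)%E /\ (conj_inf u < +oo)%E)) /\
  (* (ii) *)
  (forall u : R, 0 <= u ->
     ((0 <= u /\ (u%:E <= gamma)%E) <->
        is_min (conj_feasible f_ u) (conj_objective f_) (fconj f u)) /\
     (is_min (conj_feasible f_ u) (conj_objective f_) (fconj f u) <->
        is_min (entropy_feasible sigma u) entropy_objective (fconj f u)) /\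
     (u = 0 ->
        is_min_at (entropy_feasible sigma u) entropy_objective (fconj f u)
          (fun=> 0)) /\
     (forall x : R, I x ->
        derivable (fine \o f) x 1 /\
        (u = (fine \o f)^`()%classic x ->
           is_min_at (entropy_feasible sigma u) entropy_objective (fconj f u)
             (fun n => expR (sigma n * x)))) /\
     (u%:E = gamma ->
        is_min_at (entropy_feasible sigma u) entropy_objective (fconj f u)
          (fun n => expR (- sigma n * alpha)) /\
        0 < alpha /\
        dom_subdiff f (- alpha) /\
        dom_subdiff f = edom f /\
        has_left_derivative f (- alpha) gamma)) /\
  (* (iii) *)
  (forall u : R, 0 <= u ->
     fconj f u = conj_inf u /\ fconj f u = entropy_inf u).
Proof.
move=> f_ f conj_inf entropy_inf.
have conj_infE u : conj_inf u = entropy_inf u.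
  by rewrite /conj_inf (conj_image_entropy _ sigma_gt0).
have entropy_cvg u v : entropy_feasible sigma u v ->
    cvgn (entropy_partial v) /\ (-oo < entropy_objective v < +oo)%E.
  move=> /(entropy_feasible_summable _ sigma_gt0 sigma_infty domf_neq0)[L vL].
  rewrite (entropy_objectiveE _ _ vL) ltNyr ltry.
  by split=> //; exact: cvgP (sums_to_EFin vL).
split; first exact: edom_exp_series_ray.
split.
  move=> u v vu; rewrite /conj_objective (conj_partial_entropy _ sigma_gt0 _ _ vu).
  move: vu => /(conj_feasible_entropy _ sigma_gt0) /entropy_cvg[cvg_v /andP[]].
  by [].
split; first by move=> u v /entropy_cvg[? /andP[]].
move=> alpha alpha_ge0; set b := - alpha => I Idom domI gamma.
have summable_ltb x : x < b -> cvgn (series (moment_term sigma 0 x)).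
  by move=> xb; apply/edom_exp_series => //; apply: Idom; rewrite /I /= in_itv.
have summable_leb x : cvgn (series (moment_term sigma 0 x)) -> x <= b.
  by move=> /(edom_exp_series _ sigma_gt0)/domI; rewrite closure_ray /= in_itv.
have gammaE : gamma = (\sum_(0 <= n <oo) (moment_term sigma 1 b n)%:E)%E.
  by apply: eq_eseriesr => n _; rewrite /moment_term expr1 mulNr mulrN.
clearbody gamma.
have gamma_ge0 : (0 <= gamma)%E.
  rewrite gammaE; apply: nneseries_ge0 => n _ _.
  by rewrite lee_fin ltW ?moment_term_gt0.
have gamma_sums c : gamma = c%:E -> sums_to (moment_term sigma 1 b) c.
  move=> gc; have /cvg_ex[/= c' bc'] : cvgn (series (moment_term sigma 1 b)).
    apply: nnseries_is_cvg => [n|]; first by rewrite ltW ?moment_term_gt0.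
    by rewrite -gammaE gc ltry.
  by move: gc; rewrite gammaE (nneseries_sums_to bc') => -[<-].
have gamma_cases : gamma = +oo%E \/
    exists2 c, gamma = c%:E & sums_to (moment_term sigma 1 b) c.
  move: gamma_ge0; case gE : gamma => [c| |]// _; last by left.
  by right; exists c => //; exact: gamma_sums.
have moment1_surj u : 0 < u -> (u%:E < gamma)%E ->
    exists2 x, x < b & moment sigma 1 x = u.
  move=> u0 ug; suff [N uN] : exists N, u < series (moment_term sigma 1 b) N.
    exact: (moment_surjective _ _ sigma_gt0 sigma_infty summable_ltb _ _ _ u0 uN).
  case: gamma_cases ug => [gy _|[c -> bc]].
    apply: series_moment_unbounded => // /cvg_ex[c /nneseries_sums_to].
    by rewrite -gammaE gy.
  rewrite lte_fin => /(cvgr_gt _ bc)[N _ /(_ N (leqnn N))].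
  by exists N.
have moment1_lt x : x < b ->
    0 < moment sigma 1 x /\ ((moment sigma 1 x)%:E < gamma)%E.
  move=> xb; split; first exact: moment_gt0 xb.
  case: gamma_cases => [->|[c -> bc]]; first by rewrite ltry.
  (* The intermediate point [y] supplies the strict inequality; from [y] to [b] a weak termwise
     comparison is enough. *)
  have [xy yb] := midf_lt xb.
  rewrite lte_fin.
  apply: lt_le_trans (moment_lt _ _ sigma_gt0 summable_ltb 1 _ _ xy yb) _.
  apply: sums_to_le (moment_sums _ _ sigma_gt0 summable_ltb 1 _ yb) bc => n.
  by apply: moment_term_le => //; exact: ltW.
have min_at_x x : x < b ->
  is_min_at (entropy_feasible sigma (moment sigma 1 x)) entropy_objective
    (fconj f (moment sigma 1 x)) (fun n => expR (sigma n * x)).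
  move=> xb; apply: is_min_at_moment_term => //; exact: moment_sums xb.
have fconj_le_inf u : (fconj f u <= entropy_inf u)%E.
  by apply: le_ereal_inf_tmp => _ [v vu <-]; exact: fconj_le_entropy.
have min_at_0 :
    is_min_at (entropy_feasible sigma 0) entropy_objective (fconj f 0) (fun=> 0).
  have zero_sums : sums_to (fun=> 0 : R) 0.
    have := @finite_support_sums_to R (fun=> 0) 0 (fun _ _ => erefl).
    by rewrite big_nil.
  have zero_feasible : entropy_feasible sigma 0 (fun=> 0).
    by split=> //; apply: eq_sums_to zero_sums => n; rewrite mulr0.
  have zero_obj : entropy_objective (fun=> 0 : R) = 0%E.
    apply: entropy_objectiveE; apply: eq_sums_to zero_sums => n.
    by rewrite /entropy_term mul0r.
  (* The upper bound is weak duality against the zero sequence; the lower bound holds because the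
     series takes arbitrarily small values far to the left. *)
  have fconj0 : fconj f 0 = 0%E.
    apply/eqP; rewrite eq_le -{1}zero_obj fconj_le_entropy//=.
    apply/lee_addgt0Pr => e e0.
    have [x xb xe] :=
      moment_arbitrarily_small _ _ sigma_gt0 sigma_infty summable_ltb 0 _ e0.
    have := fconj_exp_series_ge sigma x 0 _
      (moment_sums _ _ sigma_gt0 summable_ltb 0 _ xb).
    move=> /(leeD2r e%:E); apply: le_trans; rewrite -EFinD lee_fin; lra.
  split=> //; first by rewrite zero_obj.
  apply/eqP; rewrite eq_le fconj_le_inf fconj0 -zero_obj.
  by apply: ereal_inf_lbound; exists (fun=> 0).
have min_at_gamma c : gamma = c%:E ->
    exists2 l : R, sums_to (moment_term sigma 0 b) l &
    is_min_at (entropy_feasible sigma c) entropy_objective (fconj f c)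
          (fun n => expR (- sigma n * alpha)).
  move=> /gamma_sums bc.
  have /cvg_ex[/= l bl] := moment_summable_pred _ sigma_gt0 sigma_infty 0 _ (cvgP _ bc).
  exists l => //.
  have := is_min_at_moment_term _ sigma_gt0 sigma_infty domf_neq0 _ _ _ bl bc.
  by congr is_min_at; apply/funext => n; rewrite mulNr mulrN.
have min_iff u : 0 <= u -> (u%:E <= gamma)%E <->
    is_min (entropy_feasible sigma u) entropy_objective (fconj f u).
  move=> u0; split.
    rewrite le_eqVlt => /predU1P[/esym/min_at_gamma[l _ minu]|ug].
      by eexists; exact: minu.
    move: u0; rewrite le_eqVlt => /predU1P[<-|u0]; first by eexists; exact: min_at_0.
    have [x xb <-] := moment1_surj _ u0 ug.
    by eexists; exact: min_at_x.
  move=> [v [vu vmin _]]; rewrite leNgt; apply/negP => gu.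
  case: gamma_cases gu => [->//|[c -> bc]]; rewrite lte_fin => cu.
  have uc := entropy_min_beyond _ _ sigma_gt0 sigma_infty summable_ltb
    summable_leb _ _ _ bc (ltW cu) vu vmin.
  by rewrite uc ltxx in cu.
have inf_lty u : 0 <= u -> (entropy_inf u < +oo)%E.
  move=> /(entropy_feasible_neq0 _ sigma_gt0)[v vu].
  have [_ /andP[_]] := entropy_cvg _ _ vu.
  by apply: le_lt_trans; apply: ereal_inf_lbound; exists v.
have strong u : 0 <= u -> fconj f u = entropy_inf u.
  (* Up to [gamma] the infimum is attained. Beyond it [gamma] is finite, and the truncated problems
     give the missing inequality. *)
  move=> u0; have [/(min_iff _ u0)[v [_ _ ->]]//|gu] := leP u%:E gamma.
  case: gamma_cases gu => [->//|[c gc bc]]; rewrite gc lte_fin => cu.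
  have [l bl _] := min_at_gamma _ gc.
  apply/eqP; rewrite eq_le fconj_le_inf.
  have c0 : 0 <= c by rewrite -lee_fin -gc.
  apply: le_trans (entropy_inf_le_beyond _ _ sigma_gt0 sigma_infty summable_leb
    _ _ _ bl bc (le_lt_trans c0 cu) cu) _.
  exact: fconj_exp_series_ge.
have derive_moment x : x < b -> is_derive x 1 (fine \o f) (moment sigma 1 x).
  by move=> xb; apply: (is_derive_exp_series _ b).
have subdiff_moment x : x < b -> subdiff f x (moment sigma 1 x).
  move=> xb; apply: subdiff_exp_series => //; exact: moment_sums xb.
(* The domain lies between the open ray and its closure, which have the same interior. *)
have int_dom : interior (edom f) = `]-oo, b[%classic.
  apply/seteqP; split.
    rewrite -(interior_itv_Nybnd b false) -closure_ray; exact: interiorS.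
  rewrite -{1}(interior_itv_Nybnd b true); exact: interiorS.
split.
  split=> //; split.
    apply/seteqP; split=> u.
      move=> [x]; rewrite int_dom /= in_itv /= => xb.
      move=> /(subdiff_exp_series_unique _ _ sigma_gt0 summable_ltb _ _ xb) ->.
      exact: moment1_lt.
    move=> /= [/moment1_surj h /h[x xb <-]]; exists x; last exact: subdiff_moment.
    by rewrite int_dom /= in_itv.
  split.
    apply/seteqP; split=> u; rewrite /edom /= in_itv /= andbT.
      apply: contraTT; rewrite -ltNge => u_lt0.
      have b1b : b - 1 < b by rewrite gtrBl.
      (* By monotonicity the series is bounded on the ray ending at [b - 1], so its conjugate is
         infinite at negative [u]. *)
      rewrite (@fconj_lt0 _ f (b - 1) (moment sigma 0 (b - 1)) u) ?ltxx// => y yb1.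
      have yb := le_lt_trans yb1 b1b.
      rewrite /f (exp_series_moment _ _ sigma_gt0 summable_ltb _ yb).
      by rewrite lee_fin; exact: (moment_le _ _ sigma_gt0 summable_ltb).
    by move=> /inf_lty; exact: le_lt_trans.
  by move=> u u0; rewrite conj_infE; split; [exact: fconj_le_inf|exact: inf_lty].
split; last by move=> u u0; rewrite conj_infE; split; exact: strong.
move=> u u0; rewrite (is_min_conj_entropy _ sigma_gt0).
split; first by split=> [[_]|] /(min_iff _ u0).
split=> //; split; first by move=> ->.
split.
  move=> x; rewrite /I /= in_itv /= => xb; have [dx dxE] := derive_moment _ xb.
  by split=> // ->; rewrite derive1E dxE; exact: min_at_x.
move=> /esym gu; have [l bl minu] := min_at_gamma _ gu.
have bu := gamma_sums _ gu.
have sub_b := subdiff_exp_series _ sigma_gt0 _ _ _ bl bu.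
split=> //; split.
  by rewrite -oppr_lt0; apply: (summable_lt0 _ sigma_gt0); exact: cvgP bl.
split; first by exists u.
split; last by rewrite gu; exact: left_derivative_exp_series bl bu.
(* Conversely, a domain point is either [b], where [u] is a subgradient, or lies to its left, where
   the first moment is one. *)
apply/seteqP; split=> x; first by move=> [d []].
move=> /(edom_exp_series _ sigma_gt0)/summable_leb.
rewrite le_eqVlt => /predU1P[->|xb].
  by exists u.
by exists (moment sigma 1 x); exact: subdiff_moment.
Qed.
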